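(* Let $T>0$, $x_0\in\mathbb{R}$, $K>0$, $\lambda\ge1$, $\alpha\in[0,1/2]$, $\eta:=1/2+\alpha$. Let $b,\sigma:\mathbb R\to\mathbb R$ be Borel measurable with $\sup_x|b(x)|\le K$, $|\sigma(x)-\sigma(y)|\le K|x-y|^\eta$ for all $x,y\in\mathbb R$, and $\lambda^{-1}\le\sigma^2(x)\le\lambda$ for all $x\in\mathbb R$. Let $X$ be the solution of $X_t=x_0+\int_0^tb(X_s)\,ds+\int_0^t\sigma(X_s)\,dW_s$, $t\in[0,T]$. Then there exists a constant $C\ge1$, depending only on $K,T,\alpha,\lambda,x_0$, such that for any $y\in\mathbb R$ and $t\in(0,T]$ the density $p_t(x_0,\cdot)$ of $X_t$ satisfies $$p_t(x_0,y)\le C\,p_{8\lambda}(t,x_0,y),\qquad\text{where } p_c(t,x,z):=\frac{e^{-\frac{|x-z|^2}{2ct}}}{\sqrt{2\pi ct}}.$$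
   Context: $W$ is a standard one-dimensional Brownian motion on a filtered probability space satisfying the usual conditions; under the stated hypotheses the SDE has a unique strong solution. It is known (Bally and Kohatsu-Higa) that for every $t\in(0,T]$ the random variable $X_t$ has a density $p_t(x_0,\cdot)$ given, with $a:=\sigma^2$, by the convergent expansion $$p_t(x_0,y)=p_t^{y}(x_0,y)+\sum_{m=1}^\infty \hat I_t^m(y,x_0),$$ where $$p_t^z(x,y):=\frac{1}{\sqrt{2\pi a(z)t}}e^{-\frac{|y-x-b(z)t|^2}{2a(z)t}},$$ $$\hat\theta_t(x,z):=\frac{a(x)-a(z)}{2}\Big\{\frac{(z-x-b(z)t)^2}{t^2a^2(z)}-\frac1{ta(z)}\Big\}-(b(x)-b(z))\frac{z-x-b(z)t}{ta(z)},$$ $$\hat I_{t_0}^m(y_0,y_{m+1}):=\int_0^{t_0}dt_1\cdots\int_0^{t_{m-1}}dt_m\int_{\mathbb R^m}dy_1\cdots dy_m\prod_{i=0}^{m-1}\hat\theta_{t_i-t_{i+1}}(y_{i+1},y_i)\,p^{y_i}_{t_i-t_{i+1}}(y_{i+1},y_i)\;p^{y_m}_{t_m}(y_{m+1},y_m).$$ The density in the claim is this version. *)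

(* Defs.v *)
From mathcomp Require Import all_boot all_order all_algebra.
From mathcomp Require Import all_classical all_reals all_analysis.

Set Implicit Arguments.
Unset Strict Implicit.
Unset Printing Implicit Defensive.

Import Order.TTheory GRing.Theory Num.Theory.
Import numFieldNormedType.Exports.

Local Open Scope classical_set_scope.
Local Open Scope ring_scope.

Section stochastic_calculus.
Context {d : measure_display} {Omega : measurableType d} {R : realType}.
Variable P : probability Omega R.
(* Time runs over [0, +oo[; the values of [Fil], [W], [X] at negative times
   are irrelevant. *)
Variable Fil : R -> set (set Omega).

Definition measurable_wrt (G : set (set Omega)) (f : Omega -> R) : Prop :=
  forall A : set R, measurable A -> G (f @^-1` A).

Record filtration_usual : Prop := FiltrationUsual {
  filtration_sigma : forall t : R, 0 <= t -> sigma_algebra setT (Fil t);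
  filtration_sub : forall t : R, 0 <= t -> Fil t `<=` measurable;
  filtration_mono : forall s t : R, 0 <= s -> s <= t -> Fil s `<=` Fil t;
  filtration_right_continuous : forall t : R, 0 <= t ->
    \bigcap_(s in [set s : R | t < s]) Fil s `<=` Fil t;
  (* [P.-negligible N] does not require [N] to be measurable, so this also
     forces the probability space to be complete. *)
  filtration_complete : forall N, P.-negligible N -> Fil 0 N }.

Definition increment (W : R -> Omega -> R) (s t : R) (w : Omega) : R :=
  W t w - W s w.

Record brownian_motion (W : R -> Omega -> R) : Prop := BrownianMotion {
  bm_adapted : forall t : R, 0 <= t -> measurable_wrt (Fil t) (W t);
  bm_zero : {ae P, forall w, W 0 w = 0};
  bm_continuous :
    {ae P, forall w, {within `[0, +oo[, continuous (fun t => W t w)}};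
  bm_gaussian : forall s t : R, 0 <= s -> s < t ->
    forall B : set R, measurable B ->
      P (increment W s t @^-1` B) =
      normal_prob 0 (Num.sqrt (t - s)) B;
  bm_independent : forall s t : R, 0 <= s -> s < t ->
    forall (A : set Omega) (B : set R), Fil s A -> measurable B ->
      P (A `&` increment W s t @^-1` B) =
      (P A * P (increment W s t @^-1` B))%E }.

(* [k], [tau], [xi] encode the process
   \sum_(i < k) xi_i * 1_{]tau_i, tau_{i+1}]} on [0, t]. *)
Definition simple_process (t : R) (k : nat) (tau : nat -> R)
    (xi : nat -> Omega -> R) : Prop :=
  [/\ tau 0%N = 0, tau k = t,
      forall i, (i < k)%N -> tau i <= tau i.+1 &
      forall i, (i < k)%N -> measurable_wrt (Fil (tau i)) (xi i) /\
        exists M : R, forall w, `|xi i w| <= M].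

Definition simple_value (k : nat) (tau : nat -> R) (xi : nat -> Omega -> R)
    (s : R) (w : Omega) : R :=
  \sum_(i < k) xi i w * \1_(`]tau i, tau i.+1] : set R) s.

Definition simple_integral (W : R -> Omega -> R) (k : nat) (tau : nat -> R)
    (xi : nat -> Omega -> R) (w : Omega) : R :=
  \sum_(i < k) xi i w * (W (tau i.+1) w - W (tau i) w).

(* [I] is (a version of) the Ito integral of [H] against [W] over [0, t]:
   the L^2(P) limit of the integrals of simple processes converging to [H]
   in L^2(P x ds). *)
Definition is_ito_integral (W : R -> Omega -> R) (t : R)
    (H : R -> Omega -> R) (I : Omega -> R) : Prop :=
  measurable_fun setT I /\
  exists (k : nat -> nat) (tau : nat -> nat -> R)
         (xi : nat -> nat -> Omega -> R),
  [/\ forall n, simple_process t (k n) (tau n) (xi n),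
      (fun n => \int[P]_w \int[lebesgue_measure]_(s in `[0%R, t])
         ((simple_value (k n) (tau n) (xi n) s w - H s w) ^+ 2)%R%:E)%E
        @ \oo --> (0 : \bar R) &
      (fun n => \int[P]_w
         ((simple_integral W (k n) (tau n) (xi n) w - I w) ^+ 2)%R%:E)%E
        @ \oo --> (0 : \bar R)].

Record sde_solution (W : R -> Omega -> R) (b sigma : R -> R) (x0 T : R)
    (X : R -> Omega -> R) : Prop := SdeSolution {
  sde_adapted : forall t : R, 0 <= t <= T -> measurable_wrt (Fil t) (X t);
  sde_continuous :
    {ae P, forall w, {within `[0, T], continuous (fun t => X t w)}};
  sde_equation : forall t : R, 0 <= t <= T ->
    exists2 I : Omega -> R,
      is_ito_integral W t (fun s w => sigma (X s w)) I &
      {ae P, forall w, X t w =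
        x0 + \int[lebesgue_measure]_(s in `[0, t]) b (X s w) + I w} }.

(* Nonnegativity of [p] almost everywhere is a consequence. *)
Definition is_density (Y : Omega -> R) (p : R -> R) : Prop :=
  measurable_fun setT p /\
  forall A : set R, measurable A ->
    P (Y @^-1` A) = (\int[lebesgue_measure]_(y in A) (p y)%:E)%E.

End stochastic_calculus.

Section parametrix.
Context {R : realType}.

Definition gauss_kernel (c t x z : R) : R :=
  expR (- (`|x - z| ^+ 2 / (2 * c * t))) / Num.sqrt (2 * pi * c * t).

Variables b sigma : R -> R.
Local Notation a x := (sigma x ^+ 2).

Definition frozen_density (z t x y : R) : R :=
  (Num.sqrt (2 * pi * a z * t))^-1 *
  expR (- (`|y - x - b z * t| ^+ 2 / (2 * a z * t))).

(* With L and L^z the generators with coefficients (b, a) and (b(z), a(z)), and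
   d/dx p^z_t(x, z) = (z - x - b(z) t) / (t a(z)) * p^z_t(x, z),
   the identity (L - L^z) p^z_t(., z) (x) = theta_hat_t(x, z) p^z_t(x, z) that
   underlies the expansion holds with a [+] in front of the drift term
   ([sgn = false]); the formula is also written with a [-] ([sgn = true]),
   which amounts to the opposite sign convention for the first Hermite
   polynomial. *)
Definition theta_hat (sgn : bool) (t x z : R) : R :=
  (a x - a z) / 2 *
    ((z - x - b z * t) ^+ 2 / (t ^+ 2 * a z ^+ 2) - (t * a z)^-1)
  + (-1) ^+ sgn * ((b x - b z) * ((z - x - b z * t) / (t * a z))).

(* \int_0^t ds_1 \int_0^{s_1} ds_2 ... \int_0^{s_{m-1}} ds_m g [:: s_1; ...; s_m] *)
Fixpoint time_integral (m : nat) (t : R) (g : seq R -> R) : R :=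
  if m is n.+1 then
    \int[lebesgue_measure]_(s in `[0, t])
      time_integral n s (fun r => g (s :: r))
  else g [::].

(* Integral over R^m, as an iterated integral in the order dy_m, ..., dy_1. *)
Fixpoint space_integral (m : nat) (g : seq R -> R) : R :=
  if m is n.+1 then
    \int[lebesgue_measure]_(y in [set: R])
      space_integral n (fun r => g (y :: r))
  else g [::].

(* [ts] lists t_0, ..., t_m and [ys] lists y_0, ..., y_{m+1}. *)
Definition parametrix_integrand (sgn : bool) (m : nat) (ts ys : seq R) : R :=
  (\prod_(i < m)
     (theta_hat sgn (ts`_i - ts`_i.+1) ys`_i.+1 ys`_i *
      frozen_density ys`_i (ts`_i - ts`_i.+1) ys`_i.+1 ys`_i)) *
  frozen_density ys`_m ts`_m ys`_m.+1 ys`_m.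

Definition I_hat (sgn : bool) (m : nat) (t0 y0 yend : R) : R :=
  time_integral m t0 (fun ts =>
    space_integral m (fun ys =>
      parametrix_integrand sgn m (t0 :: ts) (y0 :: rcons ys yend))).

Definition parametrix_expansion (sgn : bool) (t x0 y v : R) : Prop :=
  (fun n => frozen_density y t x0 y + \sum_(1 <= m < n.+1) I_hat sgn m t y x0)
    @ \oo --> v.

End parametrix.

(* Main.v *)
Require Import Defs.
From mathcomp Require Import all_boot all_order all_algebra.
From mathcomp Require Import all_classical all_reals all_analysis.
From mathcomp Require Import measurable_realfun ring lra.
Import Order.TTheory GRing.Theory Num.Theory.
Import numFieldNormedType.Exports.
Local Open Scope classical_set_scope.
Local Open Scope ring_scope.

(* Replacing the Hoelder exponent by 1/2 (sigma is bounded),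
   |a(x) - a(z)| <= A |x - z|^(1/2), and absorbing powers of |x - z|^2 / s into
   half of the Gaussian exponent gives
     |theta_hat_s(x, z) p^z_s(x, z)| <= M s^(-3/4) G_s(x, z),   G = p_(8 lambda),
   so by Chapman-Kolmogorov the space integral in the m-th term is at most
   M^(m+1) G_t(x0, y) prod_i (t_i - t_(i+1))^(-3/4).
   For the time integrals, instead of evaluating Beta functions, propagate the
   weight e^(rho t): since (rho r)^(1/8) e^(-rho r) <= 1,
     int_0^t (t - s)^(-3/4) e^(rho s) ds
       <= e^(rho t) rho^(-1/8) int_0^t (t - s)^(-7/8) ds <= q e^(rho t),
   where q = 8 (T / rho)^(1/8).  Taking rho with M q <= 1/2 makes the m-th term
   at most M 2^(-m) e^(rho T) G_t(x0, y), a summable bound.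
   Only upper bounds on the iterated integrals occur, and the integral of a
   nonnegative function is a supremum over simple functions, hence monotone even
   for nonmeasurable integrands.  At coinciding times the integrand is 0
   because x / 0 = 0. *)

(** * Upper bounds for integrals by domination *)

Section domination.
Context {d : measure_display} {T : measurableType d} {R : realType}.
Variable mu : {measure set T -> \bar R}.

Lemma ge0_integral_dom (D : set T) (f g : T -> \bar R) :
  (forall x, D x -> 0 <= f x)%E -> (forall x, D x -> f x <= g x)%E ->
  (\int[mu]_(x in D) f x <= \int[mu]_(x in D) g x)%E.
Proof.
move=> f0 fg.
have g0 x : D x -> (0 <= g x)%E by move=> Dx; rewrite (le_trans (f0 x Dx))// fg.
rewrite !ge0_integralE//; apply: ge_ereal_sup => _ [h/= hf <-].
apply: ereal_sup_ubound; exists h => //= x.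
rewrite (le_trans (hf x))// /patch; case: ifPn => // /set_mem; exact: fg.
Qed.

(** The positive and negative parts of [f] both lie between 0 and [g], so their integrals are finite
    and lie in [0, B]; the difference of two such numbers has modulus at most B. *)
Lemma norm_Rintegral_le (D : set T) (f g : T -> R) (B : R) :
  (forall x, D x -> `|f x| <= g x) ->
  (\int[mu]_(x in D) (g x)%:E <= B%:E)%E ->
  `|\int[mu]_(x in D) f x| <= B.
Proof.
move=> fg gB.
have bound (h : T -> \bar R) : (forall x, D x -> 0 <= h x <= (g x)%:E)%E ->
    exists2 r : R, (\int[mu]_(x in D) h x)%E = r%:E & 0 <= r <= B.
  move=> hg.
  have i0 : (0 <= \int[mu]_(x in D) h x)%E.
    by apply: integral_ge0 => x /hg /andP[].
  have iB : (\int[mu]_(x in D) h x <= B%:E)%E.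
    apply: le_trans gB; apply: ge0_integral_dom => x /hg /andP[]//.
  move: i0 iB; case: (integral _ _ _) => [r||]//.
  by rewrite !lee_fin => r0 rB; exists r => //; rewrite r0.
have g0 x : D x -> 0 <= g x by move=> Dx; rewrite (le_trans _ (fg x Dx)).
have hp x : D x -> (0 <= (EFin \o f)^\+ x <= (g x)%:E)%E.
  move=> Dx; rewrite funepos_ge0/= funeposE ge_max/= !lee_fin g0// andbT.
  by rewrite (le_trans (ler_norm _))// fg.
have hn x : D x -> (0 <= (EFin \o f)^\- x <= (g x)%:E)%E.
  move=> Dx; rewrite funeneg_ge0/= funenegE ge_max/= !lee_fin g0// andbT.
  by rewrite (le_trans (ler_norm _))// normrN fg.
have [r rE /andP[r0 rB]] := bound _ hp.
have [s sE /andP[s0 sB]] := bound _ hn.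
rewrite /Rintegral integralE rE sE/= ler_norml; lra.
Qed.

End domination.

(** * Integrals of powers with a singularity at the right endpoint *)

Section singular_integral.
Context {R : realType}.
Notation mu := (@lebesgue_measure R).

Lemma measurable_powR_subl (D : set R) (t e : R) :
  measurable_fun D (fun s : R => (t - s) `^ e).
Proof.
apply: measurable_funTS.
apply: (@measurableT_comp _ _ _ _ _ _ (@powR R ^~ e)) => //.
exact: measurable_funB.
Qed.

(** Fundamental theorem of calculus; stopping at [u < t] keeps the antiderivative -(t - s)^be / be
    smooth up to the endpoint. *)
Lemma integral_powR_subl_lt (t u be : R) : 0 < be -> 0 < u < t ->
  (\int[mu]_(s in `[0%R, u]) ((t - s) `^ (be - 1))%:E
    = ((t `^ be - (t - u) `^ be) / be)%:E)%E.
Proof.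
move=> be0 /andP[u0 ut].
pose F (s : R) : R := - be^-1 * (t - s) `^ be.
have dF (x : R) : x < t -> is_derive x 1 F ((t - x) `^ (be - 1)).
  move=> xt.
  have h : 0 < t - x by rewrite subr_gt0.
  have H1 : is_derive x 1 (fun s => t - s) (- 1).
    by apply: is_derive_eq; rewrite add0r mul1r.
  have := @is_derive1_comp _ (fun y : R => y `^ be) (fun s => t - s) x _ _
     (is_derive1_powR be h) H1.
  move=> H2.
  have := is_deriveZ (- be^-1) H2.
  rewrite /F => H3; apply: is_derive_eq H3 _.
  by rewrite /GRing.scale/=; field; rewrite gt_eqF.
have cF (x : R) : x < t -> {for x, continuous F}.
  move=> xt; apply: differentiable_continuous; apply/derivable1_diffP.
  by case: (dF x xt).
rewrite (@continuous_FTC2 _ _ F)//.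
- by rewrite -EFinB /F subr0; congr EFin; field; rewrite gt_eqF.
- apply: continuous_in_subspaceT => x; rewrite inE/= in_itv/= => /andP[x0 xu].
  have xt : x < t by lra.
  have h : 0 < t - x by rewrite subr_gt0.
  apply: (@continuous_comp _ _ _ (fun s => t - s) (fun y : R => y `^ (be - 1))).
    by apply: cvgB; [exact: cvg_cst|exact: cvg_id].
  apply: differentiable_continuous; apply/derivable1_diffP.
  by case: (is_derive1_powR (be - 1) h).
- split.
  + move=> x; rewrite in_itv/= => /andP[x0 xu]; have [] := dF x; [lra|done].
  + by apply: cvg_at_right_filter; apply: cF; lra.
  + by apply: cvg_at_left_filter; apply: cF; lra.
- move=> x; rewrite in_itv/= => /andP[x0 xu].
  rewrite derive1E; by have [|_ ->] := dF x; [lra|].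
Qed.

(** Monotone convergence along intervals [0, u_n] that exhaust [0, t[; the endpoint [t] has measure
    zero. *)
Lemma integral_powR_subl_le (t be : R) : 0 <= t -> 0 < be ->
  (\int[mu]_(s in `[0%R, t]) ((t - s) `^ (be - 1))%:E <= (t `^ be / be)%:E)%E.
Proof.
move=> t0 be0.
have [->|tn0] := eqVneq t 0.
  by rewrite set_itv1 integral_set1 lee_fin divr_ge0 ?powR_ge0// ltW.
have {tn0} t0 : 0 < t by rewrite lt0r tn0.
(* The shift by 2 makes [u 0] already positive. *)
pose u (n : nat) := t - t / n.+2%:R.
pose E n : set R := `[0, u n]%classic.
have un n : 0 < u n < t.
  by rewrite /u subr_gt0 ltr_pdivrMr// ltr_pMr// ltr1n/= gtrBl divr_gt0.
have UE : \bigcup_n E n = `[0, t[%classic.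
  apply/seteqP; split => x.
    move=> [n _]; rewrite /E/= !in_itv/= => /andP[-> xu]/=.
    by rewrite (le_lt_trans xu)//; case/andP: (un n).
  rewrite /= in_itv/= => /andP[x0 xt].
  have tx : 0 < t - x by rewrite subr_gt0.
  (* For this n, t / (t - x) < n + 1 < n + 2, that is, x < t - t / (n + 2). *)
  exists (Num.trunc (t / (t - x))) => //=; rewrite /E/= in_itv/= x0/= /u.
  rewrite lerBrDr -lerBrDl ler_pdivrMr// mulrC -ler_pdivrMr//.
  rewrite ltW//; apply: lt_trans (truncnS_gt _) _; by rewrite ltr_nat.
rewrite -integral_itv_bndo_bndc; last first.
  by apply/measurable_EFinP; exact: measurable_powR_subl.
rewrite -UE.
have nd : nondecreasing_seq E.
  move=> n m nm; rewrite subsetEset => x; rewrite /E/= !in_itv/= => /andP[-> xu]/=.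
  by rewrite (le_trans xu)// lerB// ler_pM2l// lef_pV2 ?posrE// ler_nat.
have cv : (\int[mu]_(s in E n) ((t - s) `^ (be - 1))%:E @[n --> \oo] -->
    \int[mu]_(s in \bigcup_n E n) ((t - s) `^ (be - 1))%:E)%E.
  apply: ge0_nondecreasing_set_cvg_integral => //.
  - by move=> i; exact: measurable_itv.
  - by move=> i; apply/measurable_EFinP; exact: measurable_powR_subl.
  - by move=> i x _; rewrite lee_fin powR_ge0.
apply: cvge_le cv; apply: nearW => n; rewrite /E integral_powR_subl_lt// lee_fin.
by rewrite ler_pM2r ?invr_gt0// gerBl powR_ge0.
Qed.

End singular_integral.

(** * The Gaussian kernel and Chapman-Kolmogorov *)

Section gauss_kernel.
Context {R : realType}.
Variable c : R.
Hypothesis c_gt0 : 0 < c.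
Notation mu := (@lebesgue_measure R).

Lemma gauss_kernel_ge0 (t x y : R) : 0 <= gauss_kernel c t x y.
Proof. by rewrite divr_ge0 ?expR_ge0. Qed.

Lemma gauss_kernelC (t x y : R) : gauss_kernel c t x y = gauss_kernel c t y x.
Proof. by rewrite /gauss_kernel distrC. Qed.

Lemma gauss_kernel0 (x y : R) : gauss_kernel c 0 x y = 0.
Proof. by rewrite /gauss_kernel !mulr0 sqrtr0 invr0 mulr0. Qed.

(** Completing the square in [z]: the second factor is the law of the Brownian bridge from x to y,
    of total length s + t, at time s. *)
Lemma gauss_kernelM (s t x y z : R) : 0 < s -> 0 < t ->
  gauss_kernel c s x z * gauss_kernel c t z y = gauss_kernel c (s + t) x y *
    normal_pdf ((t * x + s * y) / (s + t)) (Num.sqrt (c * s * t / (s + t))) z.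
Proof.
move=> s0 t0.
have st0 : 0 < s + t by rewrite addr_gt0.
have pi0 := pi_gt0 R.
have v0 : 0 < c * s * t / (s + t) by rewrite divr_gt0 ?mulr_gt0.
rewrite normal_pdfE; last by rewrite gt_eqF// sqrtr_gt0.
rewrite /gauss_kernel /normal_peak /normal_fun sqr_sqrtr ?(ltW v0)//.
rewrite [X in _ = _ * X]mulrC [LHS]mulrACA [RHS]mulrACA -!expRD -!invfM.
congr (expR _ * _^-1).
  rewrite !real_normK ?num_real//; field.
  by rewrite !gt_eqF// ?mulr_gt0.
rewrite -!sqrtrM ?mulr_ge0 ?ltW//; congr Num.sqrt.
by field; rewrite gt_eqF.
Qed.

(** The bridge density has mass 1. Only an inequality holds at [s = 0] or [t = 0], where the kernel
    takes the default value 0 instead of being a Dirac mass. *)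
Lemma gauss_kernel_convolution_le (k s t x y : R) : 0 <= k -> 0 <= s -> 0 <= t ->
  (\int[mu]_z (k * (gauss_kernel c s x z * gauss_kernel c t z y))%:E
    <= (k * gauss_kernel c (s + t) x y)%:E)%E.
Proof.
move=> k0; rewrite [0 <= s]le_eqVlt => /predU1P[<-|s0].
  under eq_integral do rewrite gauss_kernel0 mul0r mulr0.
  by rewrite integral0 lee_fin mulr_ge0// gauss_kernel_ge0.
rewrite [0 <= t]le_eqVlt => /predU1P[<-|t0].
  under eq_integral do rewrite gauss_kernel0 !mulr0.
  by rewrite integral0 lee_fin mulr_ge0// gauss_kernel_ge0.
under eq_integral do rewrite gauss_kernelM// mulrA EFinM.
rewrite ge0_integralZl//=.
- by rewrite integral_normal_pdf ?mule1.
- by apply/measurable_EFinP; exact: measurable_normal_pdf.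
- by move=> z _; rewrite lee_fin normal_pdf_ge0.
- by rewrite lee_fin mulr_ge0// gauss_kernel_ge0.
Qed.

End gauss_kernel.

Section kernel_bound.
Context {R : realType}.
Variables (T K lambda alpha : R).
Hypotheses (T_gt0 : 0 < T) (K_gt0 : 0 < K) (lambda_ge1 : 1 <= lambda).
Hypothesis alpha_ge0 : 0 <= alpha.
Variables (b sigma : R -> R).
Hypothesis b_le : forall x, `|b x| <= K.
Hypothesis sigma_holder : forall x y,
  `|sigma x - sigma y| <= K * (`|x - y| `^ (1 / 2 + alpha)).
Hypothesis sigma_sqr : forall x, lambda^-1 <= sigma x ^+ 2 <= lambda.
Local Notation a x := (sigma x ^+ 2).
Local Notation G := (gauss_kernel (8 * lambda)).

Let lambda_gt0 : 0 < lambda. Proof. exact: lt_le_trans lambda_ge1. Qed.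

Let a_gt0 x : 0 < a x.
Proof. by have /andP[+ _] := sigma_sqr x; apply: lt_le_trans; rewrite invr_gt0. Qed.

Let a_le x : a x <= lambda. Proof. by case/andP: (sigma_sqr x). Qed.

Let inv_a_le x : (a x)^-1 <= lambda.
Proof.
by have /andP[h _] := sigma_sqr x; rewrite -[leRHS]invrK lef_pV2 ?posrE ?invr_gt0.
Qed.

(** For |x - z| <= 1, factor a(x) - a(z) as a difference of squares and lower the exponent 1/2 +
    alpha to 1/2. For |x - z| > 1, both values lie in ]0, lambda] and the square root exceeds 1. *)
Lemma diffusion_sqrt_holder x z :
  `|a x - a z| <= (2 * K * lambda + lambda) * Num.sqrt `|x - z|.
Proof.
have sig y : `|sigma y| <= lambda.
  rewrite -(@ler_pXn2r _ 2) ?nnegrE ?(ltW lambda_gt0)// real_normK ?num_real//.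
  by rewrite (le_trans (a_le y))// ler_eXnr.
have r0 : 0 <= `|x - z| by [].
have al0 := alpha_ge0; have l0 := lambda_gt0; have k0 := K_gt0.
have [r1|r1] := leP `|x - z| 1.
- rewrite subr_sqr normrM mulrC.
  have h1 : `|sigma x + sigma z| <= 2 * lambda.
    by rewrite (le_trans (ler_normD _ _))// mulr_natl mulr2n lerD.
  have h2 : `|sigma x - sigma z| <= K * Num.sqrt `|x - z|.
    rewrite (le_trans (sigma_holder x z))// ler_pM2l// -powR12_sqrt//.
    move: r0; rewrite le_eqVlt => /predU1P[<-|r0].
      by rewrite !powR0 ?gt_eqF//; lra.
    by apply: ger_powR; [rewrite r0|lra].
  have := ler_pM (normr_ge0 _) (normr_ge0 _) h1 h2.
  have : 0 <= lambda * Num.sqrt `|x - z| by rewrite mulr_ge0// ltW.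
  lra.
- have s1 : 1 <= Num.sqrt `|x - z| by rewrite -[leLHS]sqrtr1 ler_sqrt// ltW.
  have h : `|a x - a z| <= lambda.
    have := a_gt0 x; have := a_gt0 z; have := a_le x; have := a_le z.
    rewrite ler_norml; lra.
  have : 0 <= K * lambda by rewrite mulr_ge0 ?ltW.
  move: h s1; nra.
Qed.

(** Removes the drift from the Gaussian exponent: the error is linear in [s], hence bounded after
    division by [s]. *)
Lemma sqr_dist_le s x z : 0 <= s <= T ->
  (x - z) ^+ 2 <= 2 * (z - x - b z * s) ^+ 2 + 2 * K ^+ 2 * T * s.
Proof.
move=> /andP[s0 sT].
have bK : b z ^+ 2 <= K ^+ 2 by rewrite -real_normK ?num_real// lerXn2r ?nnegrE// ltW.
have h1 : (x - z) ^+ 2 <= 2 * (z - x - b z * s) ^+ 2 + 2 * (b z ^+ 2 * s ^+ 2).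
  have := sqr_ge0 ((z - x - b z * s) - b z * s); nra.
have h2 : b z ^+ 2 * s ^+ 2 <= K ^+ 2 * (T * s).
  by rewrite ler_pM ?sqr_ge0// expr2 ler_wpM2r.
lra.
Qed.

(** The factor 4 lambda compares the normalizations; the exponential pays for the drift. *)
Definition frozen_const : R := 4 * lambda * expR (K ^+ 2 * T / (2 * lambda)).

Definition theta_const : R :=
  (K * lambda + lambda / 2) *
    (2 * lambda ^+ 2 * (1 + K ^+ 2 * (1 + T) ^+ 4) + lambda) +
  2 * K * lambda * (1 + K * (1 + T) ^+ 2) * (1 + T).

Lemma frozen_const_ge0 : 0 <= frozen_const.
Proof. by rewrite mulr_ge0 ?expR_ge0// mulr_ge0// ltW. Qed.

Lemma theta_const_ge0 : 0 <= theta_const.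
Proof.
have l0 := ltW lambda_gt0; have k0 := ltW K_gt0; have t0 := ltW T_gt0.
by rewrite /theta_const !(addr_ge0, mulr_ge0, exprn_ge0).
Qed.

Lemma frozen_density_le s x z : 0 < s <= T ->
  frozen_density b sigma z s x z <=
  frozen_const *
  (expR (- ((x - z) ^+ 2 / s / (8 * lambda))) * G s x z).
Proof.
move=> /andP[s0 sT]; rewrite /frozen_density /gauss_kernel.
have pi0 := pi_gt0 R; have az0 := a_gt0 z.
have p0 : 0 < 2 * a z * s by rewrite mulr_gt0// mulr_gt0.
have p1 : 0 < 2 * pi * a z * s by rewrite mulr_gt0// mulr_gt0// mulr_gt0.
have peak : (Num.sqrt (2 * pi * a z * s))^-1
    <= 4 * lambda / Num.sqrt (2 * pi * (8 * lambda) * s).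
  have p2 : 0 < 2 * pi * (8 * lambda) * s by rewrite !mulr_gt0.
  rewrite ler_pdivlMr ?sqrtr_gt0// mulrC ler_pdivrMr ?sqrtr_gt0//.
  have l4 : 0 <= 4 * lambda by rewrite mulr_ge0// ltW.
  rewrite -{1}(ger0_norm l4) -sqrtr_sqr -sqrtrM ?sqr_ge0// ler_sqrt; last first.
    by rewrite mulr_ge0 ?sqr_ge0// ltW.
  have la : 1 <= lambda * a z.
    by have /andP[+ _] := sigma_sqr z; rewrite -div1r ler_pdivrMr// mulrC.
  have : 0 <= 16 * pi * lambda * s by rewrite !mulr_ge0// ltW.
  rewrite (_ : _ * (2 * pi * a z * s) =
    2 * (16 * pi * lambda * s) * (lambda * a z)); last by ring.
  rewrite (_ : 2 * pi * (8 * lambda) * s = 16 * pi * lambda * s); last by ring.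
  nra.
have expo : expR (- (`|z - x - b z * s| ^+ 2 / (2 * a z * s))) <=
    expR (K ^+ 2 * T / (2 * lambda)) * (expR (- ((x - z) ^+ 2 / s / (8 * lambda)))
    * expR (- (`|x - z| ^+ 2 / (2 * (8 * lambda) * s)))).
  rewrite -!expRD ler_expR !real_normK ?num_real//.
  have h1 : (z - x - b z * s) ^+ 2 / (2 * lambda * s)
      <= (z - x - b z * s) ^+ 2 / (2 * a z * s).
    rewrite ler_wpM2l ?sqr_ge0// lef_pV2 ?posrE//; last by rewrite !mulr_gt0.
    by rewrite ler_pM2r// ler_pM2l.
  suff h2 : (x - z) ^+ 2 / s / (8 * lambda) + (x - z) ^+ 2 / (2 * (8 * lambda) * s)
      <= (z - x - b z * s) ^+ 2 / (2 * lambda * s) + K ^+ 2 * T / (2 * lambda) by lra.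
  have -> : (x - z) ^+ 2 / s / (8 * lambda) + (x - z) ^+ 2 / (2 * (8 * lambda) * s)
      = 3 * (x - z) ^+ 2 / (16 * lambda * s) by field; rewrite !gt_eqF.
  have -> : (z - x - b z * s) ^+ 2 / (2 * lambda * s) + K ^+ 2 * T / (2 * lambda)
      = (8 * (z - x - b z * s) ^+ 2 + 8 * (K ^+ 2 * T * s)) / (16 * lambda * s).
    by field; rewrite !gt_eqF.
  rewrite ler_pM2r ?invr_gt0 ?mulr_gt0//.
  have sT' : 0 <= s <= T by rewrite ltW.
  have := sqr_dist_le s x z sT'; have := sqr_ge0 (z - x - b z * s).
  have : 0 <= K ^+ 2 * T * s by rewrite !mulr_ge0 ?sqr_ge0 ?ltW.
  lra.
rewrite (le_trans (ler_pM _ _ peak expo)) ?invr_ge0 ?expR_ge0//.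
by rewrite le_eqVlt; apply/orP; left; apply/eqP; rewrite /frozen_const; ring.
Qed.

(** In the scaled variables h = s^(1/4) and w = (|x - z| / s^(1/2))^(1/2) all bounds become
    polynomial. The diffusion term has order h^(-4), and the square-root modulus of a gains one h;
    the drift term is only of order h^(-2). *)
Lemma theta_hat_le sgn s x z : 0 < s <= T ->
  `|theta_hat b sigma sgn s x z| <=
    theta_const * (1 + (x - z) ^+ 2 / s) ^+ 2 * s `^ (- (3 / 4)).
Proof.
move=> /andP[s0 sT].
have l0 := lambda_gt0; have k0 := K_gt0; have t0 := T_gt0.
have l_ge0 := ltW l0; have az0 := a_gt0 z; have iaz := inv_a_le z.
pose h := s `^ (1 / 4).
have h0 : 0 < h by exact: powR_gt0.
have hs : h ^+ 4 = s.
  by rewrite -powR_mulrn ?(ltW h0)// -powRrM (_ : 1 / 4 * 4%:R = 1) ?powRr1 ?ltW//; field.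
have -> : s `^ (- (3 / 4)) = (h ^+ 3)^-1.
  by rewrite powRN -powR_mulrn ?(ltW h0)// -powRrM (_ : 1 / 4 * 3%:R = 3 / 4)//; field.
(* If h >= 1 then h <= h^4 = s <= T. *)
have hT : h <= 1 + T.
  rewrite leNgt; apply/negP => Th; have h1 : 1 <= h by lra.
  by have := ler_eXnr (isT : (0 < 4)%N) h1; rewrite hs; lra.
pose w := Num.sqrt `|x - z| / h.
have w0 : 0 <= w by rewrite divr_ge0// ltW.
have qE : Num.sqrt `|x - z| = w * h by rewrite mulfVK// gt_eqF.
have rE : `|x - z| = (w * h) ^+ 2 by rewrite -qE sqr_sqrtr.
have -> : (x - z) ^+ 2 / s = w ^+ 4.
  by rewrite -real_normK ?num_real// rE -hs; field; rewrite gt_eqF.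
(* Here h^2 p = |x - z| + K s, which bounds |z - x - b(z) s|. *)
pose p := w ^+ 2 + K * h ^+ 2.
have K_ge0 := ltW k0; have h_ge0 := ltW h0.
have p0 : 0 <= p by rewrite /p addr_ge0 ?sqr_ge0// mulr_ge0 ?sqr_ge0.
pose e := (z - x - b z * s) / (s * a z).
have e_le : `|e| <= lambda * p / h ^+ 2.
  have -> : lambda * p / h ^+ 2 = (`|x - z| + K * s) / s * lambda.
    by rewrite rE -hs /p; field; rewrite gt_eqF.
  rewrite /e invfM mulrA normrM ler_pM ?normr_ge0//; last first.
    by rewrite ger0_norm// invr_ge0 ltW.
  rewrite normrM (@ger0_norm _ s^-1) ?invr_ge0 ?(ltW s0)// ler_pM2r ?invr_gt0//.
  rewrite (le_trans (ler_normB _ _))// distrC lerD2l normrM (ger0_norm (ltW s0)).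
  by rewrite ler_pM2r.
have i_le : (s * a z)^-1 <= lambda / h ^+ 4.
  by rewrite invfM mulrC hs ler_pM2r ?invr_gt0.
have i_ge0 : 0 <= (s * a z)^-1 by rewrite invr_ge0 ltW// mulr_gt0.
have D_le := diffusion_sqrt_holder x z.
have B_le : `|b x - b z| <= 2 * K.
  by rewrite (le_trans (ler_normB _ _))// mulr_natl mulr2n lerD.
have e2_le : e ^+ 2 <= (lambda * p / h ^+ 2) ^+ 2.
  by rewrite -(real_normK (num_real e)) lerXn2r ?nnegrE// (le_trans _ e_le).
have step1 : `|theta_hat b sigma sgn s x z| <=
    `|a x - a z| / 2 * (e ^+ 2 + (s * a z)^-1) + `|b x - b z| * `|e|.
  rewrite /theta_hat (le_trans (ler_normD _ _))// lerD//.
    rewrite normrM normrM (@ger0_norm _ 2^-1)// ler_wpM2l ?divr_ge0//.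
    rewrite -exprMn -expr_div_n -/e (le_trans (ler_normB _ _))//.
    by rewrite !ger0_norm ?sqr_ge0.
  (* The modulus erases the sign chosen by [sgn]. *)
  by rewrite normrM normrX normrN normr1 expr1n mul1r normrM.
rewrite (le_trans step1)//.
have step2 : `|a x - a z| / 2 * (e ^+ 2 + (s * a z)^-1) + `|b x - b z| * `|e| <=
    (2 * K * lambda + lambda) * (w * h) / 2 *
      ((lambda * p / h ^+ 2) ^+ 2 + lambda / h ^+ 4) + 2 * K * (lambda * p / h ^+ 2).
  apply: lerD; apply: ler_pM => //.
  - by rewrite addr_ge0 ?sqr_ge0.
  - by rewrite ler_pM2r ?invr_gt0// -qE.
  - exact: lerD.
rewrite (le_trans step2)//.
have -> : (2 * K * lambda + lambda) * (w * h) / 2 *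
      ((lambda * p / h ^+ 2) ^+ 2 + lambda / h ^+ 4) + 2 * K * (lambda * p / h ^+ 2)
   = ((K * lambda + lambda / 2) * (w * (lambda ^+ 2 * p ^+ 2 + lambda))
     + 2 * K * lambda * (p * h)) / h ^+ 3.
  by field; rewrite gt_eqF.
rewrite ler_pM2r ?invr_gt0 ?exprn_gt0// [leRHS]mulrDl.
(* Up to constants [Q] dominates 1, w, p and p^2, and each remaining term is at most a product of
   two of these, whence Q^2. *)
set Q := 1 + w ^+ 4.
have Q1 : 1 <= Q by rewrite lerDl exprn_ge0.
have w2Q : w ^+ 2 <= Q by rewrite /Q; have := sqr_ge0 (w ^+ 2 - 1); nra.
have wQ : w <= Q by have := sqr_ge0 (w - 1); have := sqr_ge0 w; nra.
have h2 : h ^+ 2 <= (1 + T) ^+ 2 by rewrite lerXn2r// nnegrE; lra.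
have h4 : h ^+ 4 <= (1 + T) ^+ 4 by rewrite lerXn2r// nnegrE; lra.
have pQ : p <= (1 + K * (1 + T) ^+ 2) * Q.
  have : K * h ^+ 2 <= K * (1 + T) ^+ 2 by rewrite ler_pM2l.
  have : 0 <= K * (1 + T) ^+ 2 by rewrite mulr_ge0 ?sqr_ge0// ltW.
  rewrite /p; nra.
have p2Q : p ^+ 2 <= 2 * (1 + K ^+ 2 * (1 + T) ^+ 4) * Q.
  have h4' : K ^+ 2 * h ^+ 4 <= K ^+ 2 * (1 + T) ^+ 4 by rewrite ler_pM2l// exprn_gt0.
  have t4 : 0 <= K ^+ 2 * (1 + T) ^+ 4 by rewrite mulr_ge0 ?exprn_ge0; lra.
  have := sqr_ge0 (w ^+ 2 - K * h ^+ 2).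
  have : 0 <= w ^+ 4 by rewrite exprn_ge0.
  rewrite /p /Q; nra.
apply: lerD.
  rewrite -mulrA ler_wpM2l//; first by rewrite addr_ge0 ?mulr_ge0 ?(ltW l0).
  have -> : (2 * lambda ^+ 2 * (1 + K ^+ 2 * (1 + T) ^+ 4) + lambda) * Q ^+ 2 =
    Q * (lambda ^+ 2 * (2 * (1 + K ^+ 2 * (1 + T) ^+ 4) * Q) + lambda * Q) by ring.
  rewrite ler_pM// ?addr_ge0 ?mulr_ge0 ?sqr_ge0//.
  by rewrite lerD// ?ler_wpM2l ?sqr_ge0// ler_peMr// ltW.
rewrite -!mulrA !ler_wpM2l ?(ltW l0)//.
have P0 : 0 <= (1 + K * (1 + T) ^+ 2) by rewrite addr_ge0// mulr_ge0// sqr_ge0.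
have -> : (1 + K * (1 + T) ^+ 2) * ((1 + T) * Q ^+ 2)
  = (1 + K * (1 + T) ^+ 2) * Q * ((1 + T) * Q) by ring.
rewrite ler_pM// (le_trans hT)// ler_peMr//; lra.
Qed.

(** One constant for both kernels: (16 lambda)^2 comes from absorbing (1 + v)^2, and 1 +
    [theta_const] covers the cases without and with [theta_hat]. *)
Definition kernel_const : R := frozen_const * (16 * lambda) ^+ 2 * (1 + theta_const).

Lemma kernel_const_ge0 : 0 <= kernel_const.
Proof.
have N0 := frozen_const_ge0; have M0 := theta_const_ge0.
by apply: mulr_ge0; [exact: mulr_ge0 (sqr_ge0 _)|exact: addr_ge0].
Qed.

Let frozen_density_ge0 s x z : 0 <= frozen_density b sigma z s x z.
Proof. by rewrite mulr_ge0 ?expR_ge0// invr_ge0. Qed.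

Let frozen_density0 x z : frozen_density b sigma z 0 x z = 0.
Proof. by rewrite /frozen_density !mulr0 sqrtr0 invr0 mul0r. Qed.

Lemma frozen_density_gauss_le s x z : 0 <= s <= T ->
  `|frozen_density b sigma z s x z| <= kernel_const * G s x z.
Proof.
have kG := mulr_ge0 kernel_const_ge0 (gauss_kernel_ge0 (8 * lambda) s x z).
move=> /andP[]; rewrite le_eqVlt => /predU1P[s0 _|s0 sT].
  by move: kG; rewrite -s0 frozen_density0 normr0.
rewrite ger0_norm// (le_trans (frozen_density_le s x z _)) ?s0//.
rewrite (_ : kernel_const * _ = frozen_const *
  ((16 * lambda) ^+ 2 * (1 + theta_const) * G s x z)); last by rewrite /kernel_const; ring.
rewrite ler_wpM2l ?frozen_const_ge0// ler_wpM2r ?gauss_kernel_ge0//.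
have e1 : expR (- ((x - z) ^+ 2 / s / (8 * lambda))) <= 1.
  by rewrite -expR0 ler_expR oppr_le0 !divr_ge0 ?sqr_ge0 ?(ltW s0)// mulr_ge0// ltW.
rewrite (le_trans e1)// -[leLHS]mulr1 ler_pM ?lerDl ?theta_const_ge0//.
by have := lambda_ge1; nra.
Qed.

Lemma theta_frozen_density_gauss_le sgn s x z : 0 <= s <= T ->
  `|theta_hat b sigma sgn s x z * frozen_density b sigma z s x z| <=
  kernel_const * s `^ (- (3 / 4)) * G s x z.
Proof.
have kG := mulr_ge0 (mulr_ge0 kernel_const_ge0 (powR_ge0 s (- (3 / 4))))
  (gauss_kernel_ge0 (8 * lambda) s x z).
move=> /andP[]; rewrite le_eqVlt => /predU1P[s0 _|s0 sT].
  by move: kG; rewrite -s0 frozen_density0 mulr0 normr0.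
have sT' : 0 < s <= T by rewrite s0.
rewrite normrM (ger0_norm (frozen_density_ge0 _ _ _)).
rewrite (le_trans (ler_pM _ _ (theta_hat_le sgn s x z sT') (frozen_density_le s x z sT')))//.
set v := (x - z) ^+ 2 / s; have v0 : 0 <= v by rewrite divr_ge0 ?sqr_ge0// ltW.
have l0 := lambda_gt0; have l1 := lambda_ge1.
(* Square of 1 + v <= 16 lambda e^(v / (16 lambda)), which follows from 1 + x <= e^x and 16 lambda
   >= 1. *)
have poly : (1 + v) ^+ 2 * expR (- (v / (8 * lambda))) <= (16 * lambda) ^+ 2.
  have -> : - (v / (8 * lambda)) = 2%:R * - (v / (16 * lambda)).
    by field; rewrite gt_eqF.
  rewrite expRM_natl -exprMn lerXn2r ?nnegrE ?mulr_ge0 ?expR_ge0 ?addr_ge0 ?(ltW l0)//.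
  rewrite expRN ler_pdivrMr ?expR_gt0//.
  apply: (@le_trans _ _ (16 * lambda * (1 + v / (16 * lambda)))).
    have -> : 16 * lambda * (1 + v / (16 * lambda)) = 16 * lambda + v.
      by field; rewrite gt_eqF.
    lra.
  by rewrite ler_pM2l ?mulr_gt0// expR_ge1Dx.
have N0 := frozen_const_ge0; have M0 := theta_const_ge0.
have g0 := gauss_kernel_ge0 (8 * lambda) s x z.
have p0 := powR_ge0 s (- (3 / 4)).
rewrite (_ : theta_const * _ * _ * _ = frozen_const * theta_const * s `^ (- (3 / 4))
  * G s x z * ((1 + v) ^+ 2 * expR (- (v / (8 * lambda))))); last by ring.
apply: (@le_trans _ _ (frozen_const * theta_const * s `^ (- (3 / 4))
  * G s x z * (16 * lambda) ^+ 2)).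
  by apply: ler_wpM2l poly; do 3 apply: mulr_ge0 => //.
rewrite (_ : kernel_const * _ * _ = frozen_const * (1 + theta_const) *
  s `^ (- (3 / 4)) * G s x z * (16 * lambda) ^+ 2); last by rewrite /kernel_const; ring.
by rewrite ler_wpM2r ?sqr_ge0// ler_wpM2r// ler_wpM2r// ler_wpM2l// lerDr.
Qed.

End kernel_bound.

(** * Iterated space integrals *)

Section space_iteration.
Context {R : realType}.
Variables (T c M : R) (b sigma : R -> R) (sgn : bool).
Hypotheses (c_gt0 : 0 < c) (M_ge0 : 0 <= M).
Hypothesis frozen_le : forall s x z, 0 <= s <= T ->
  `|frozen_density b sigma z s x z| <= M * gauss_kernel c s x z.
Hypothesis theta_le : forall s x z, 0 <= s <= T ->
  `|theta_hat b sigma sgn s x z * frozen_density b sigma z s x z| <=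
  M * s `^ (- (3 / 4)) * gauss_kernel c s x z.
Notation G := (gauss_kernel c).

(** The product of (t_i - t_(i+1))^(-3/4). The last kernel, of duration t_m, carries no [theta_hat]
    and so contributes no singular factor. *)
Fixpoint time_weight (t : R) (ts : seq R) : R :=
  if ts is s :: r then (t - s) `^ (- (3 / 4)) * time_weight s r else 1.

Lemma time_weight_ge0 t ts : 0 <= time_weight t ts.
Proof. by elim: ts t => //= s r IH t; rewrite mulr_ge0 ?powR_ge0. Qed.

Lemma parametrix_integrandS m t0 t1 ts y0 y1 ys :
  parametrix_integrand b sigma sgn m.+1 [:: t0, t1 & ts] [:: y0, y1 & ys] =
  theta_hat b sigma sgn (t0 - t1) y1 y0 * frozen_density b sigma y0 (t0 - t1) y1 y0 *
  parametrix_integrand b sigma sgn m (t1 :: ts) (y1 :: ys).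
Proof. by rewrite /parametrix_integrand big_ord_recl -mulrA. Qed.

(* The slack [k] absorbs the factors that involve only the outer variables. *)
Lemma space_integral_le m (k t : R) (ts : seq R) (y0 yend : R) (g : seq R -> R) :
  0 <= k -> size ts = m -> t <= T -> path >=%R t ts -> 0 <= last t ts ->
  (forall ys, size ys = m -> `|g ys| <=
     k * `|parametrix_integrand b sigma sgn m (t :: ts) (y0 :: rcons ys yend)|) ->
  `|space_integral m g| <= k * M ^+ m.+1 * time_weight t ts * G t y0 yend.
Proof.
elim: m k t ts y0 g => [|m IH] k t ts y0 g k0 + tT.
  move=> /size0nil -> /= _ t0 /(_ [::] erefl) gle; rewrite (le_trans gle)//.
  rewrite expr1 mulr1 -mulrA ler_wpM2l// gauss_kernelC.
  by rewrite /parametrix_integrand big_ord0 mul1r/= frozen_le// t0.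
case: ts => // s ts [szs] /= /andP[st pts] last0 gle.
(* The times decrease to a nonnegative last one. *)
have s0 : 0 <= s.
  elim: ts s {st gle szs} pts last0 => //= u ts IHt s /andP[us pu] /(IHt _ pu).
  by move=> u0; exact: le_trans us.
have ts0 : 0 <= t - s <= T by rewrite subr_ge0 st/= (le_trans _ tT)// gerBl.
pose A := k * M ^+ m.+2 * ((t - s) `^ (- (3 / 4)) * time_weight s ts).
have A0 : 0 <= A.
  rewrite /A mulr_ge0//; first by rewrite mulr_ge0// exprn_ge0.
  by rewrite mulr_ge0 ?powR_ge0 ?time_weight_ge0.
(* The inner variables are integrated first, leaving a two-kernel majorant in the outermost [y1];
   Chapman-Kolmogorov collapses it, since (t - s) + s = t. *)
apply: (@norm_Rintegral_le _ _ _ lebesgue_measure _ _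
    (fun y1 => A * (G (t - s) y0 y1 * G s y1 yend))); last first.
  have := gauss_kernel_convolution_le c c_gt0 A (t - s) s y0 yend A0.
  by rewrite subrK; apply => //; case/andP: ts0.
move=> y1 _.
(* The peeled kernel depends only on [y0] and [y1]; it joins the slack and is estimated after the
   induction step. *)
have := IH (k * `|theta_hat b sigma sgn (t - s) y1 y0 *
  frozen_density b sigma y0 (t - s) y1 y0|) s ts y1 (fun r => g (y1 :: r)).
move=> /(_ _ szs (le_trans st tT) pts last0) H.
apply: (le_trans (H _ _)).
- by rewrite mulr_ge0.
- move=> ys szy; apply: le_trans (gle (y1 :: ys) _) _; first by rewrite /= szy.
  by rewrite /= parametrix_integrandS normrM mulrA.
- rewrite (gauss_kernelC c _ y0).
  have -> : A * (G (t - s) y1 y0 * G s y1 yend) = k *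
    (M * (t - s) `^ (- (3 / 4)) * G (t - s) y1 y0) * M ^+ m.+1 * time_weight s ts *
    G s y1 yend by rewrite /A (exprS _ m.+1); ring.
  do 3 (rewrite ler_wpM2r ?exprn_ge0 ?time_weight_ge0 ?gauss_kernel_ge0//).
  by rewrite ler_wpM2l// theta_le.
Qed.

End space_iteration.

(** * Iterated time integrals with an exponential weight *)

Section time_iteration.
Context {R : realType}.
Variables (T rho : R).
Hypothesis rho_gt0 : 0 < rho.

(** Worsening the exponent from -3/4 to -7/8, still integrable, buys the factor rho^(-1/8), small
    for large rho. *)
Lemma weighted_singularity_le (r : R) : 0 <= r ->
  r `^ (- (3 / 4)) * expR (- (rho * r)) <= rho `^ (- (1 / 8)) * r `^ (1 / 8 - 1).
Proof.
have n0 : - (3 / 4) != 0 :> R by rewrite lt_eqF//; lra.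
rewrite le_eqVlt => /predU1P[<-|r0].
  by rewrite powR0// mul0r mulr_ge0 ?powR_ge0.
have x0 : 0 < rho * r by rewrite mulr_gt0.
have h : (rho * r) `^ (1 / 8) <= expR (rho * r).
  have [x1|x1] := leP 1 (rho * r).
    rewrite (@le_trans _ _ (rho * r))//; first by rewrite ler1_powR//; lra.
    by have := expR_ge1Dx (rho * r); lra.
  have := ge0_ler_powR (_ : 0 <= 1 / 8 :> R).
  move=> /(_ _ (rho * r) 1); rewrite powR1 !nnegrE => H.
  rewrite (@le_trans _ _ 1)//.
    by apply: H; rewrite ?ltW//; lra.
  by have := expR_ge1Dx (rho * r); lra.
rewrite expRN ler_pdivrMr ?expR_gt0//.
have -> : r `^ (- (3 / 4)) = rho `^ (- (1 / 8)) * r `^ (1 / 8 - 1) * (rho * r) `^ (1 / 8).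
  rewrite powRM ?(ltW r0) ?(ltW rho_gt0)// mulrACA.
  rewrite -[X in _ = X * _]powRD; last by rewrite (gt_eqF rho_gt0) implybT.
  rewrite -[X in _ = _ * X]powRD; last by rewrite (gt_eqF r0) implybT.
  rewrite addNr powRr0 mul1r; congr (_ `^ _); lra.
by rewrite ler_wpM2l// mulr_ge0 ?powR_ge0.
Qed.

(** The ratio q = 8 (T / rho)^(1/8); the division by 1/8 comes from integrating the power -7/8. *)
Definition time_ratio : R := rho `^ (- (1 / 8)) * (T `^ (1 / 8) / (1 / 8)).

Lemma time_ratio_ge0 : 0 <= time_ratio.
Proof. by rewrite mulr_ge0 ?divr_ge0 ?powR_ge0. Qed.

Lemma time_integral_le m (k t : R) (g : seq R -> R) :
  0 <= k -> 0 <= t <= T ->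
  (forall ts, size ts = m -> path >=%R t ts -> 0 <= last t ts ->
     `|g ts| <= k * time_weight t ts) ->
  `|time_integral m t g| <= k * time_ratio ^+ m * expR (rho * t).
Proof.
elim: m k t g => [|m IH] k t g k0 /andP[t0 tT] gle.
  rewrite /= expr0 mulr1 (le_trans (gle [::] _ _ _))//= ler_wpM2l//.
  by rewrite -expR0 ler_expR mulr_ge0// ltW.
pose A := k * time_ratio ^+ m * expR (rho * t) * rho `^ (- (1 / 8)).
have A0 : 0 <= A.
  by rewrite /A !mulr_ge0 ?exprn_ge0 ?time_ratio_ge0 ?expR_ge0 ?powR_ge0.
apply: (@norm_Rintegral_le _ _ _ lebesgue_measure _ _ (fun s => A * (t - s) `^ (1 / 8 - 1))).
- move=> s; rewrite /= in_itv/= => /andP[s0 st].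
  have r0 : 0 <= t - s by rewrite subr_ge0.
  (* The outermost singular factor is constant for the inner integrals. *)
  have := IH (k * (t - s) `^ (- (3 / 4))) s (fun r => g (s :: r)).
  rewrite s0 (le_trans st tT) => /(_ _ isT _) H.
  apply: (le_trans (H _ _)).
  + by rewrite mulr_ge0 ?powR_ge0.
  + move=> ts sz pts l0; rewrite -mulrA.
    by have := gle (s :: ts); rewrite /= sz st pts; apply.
  + have := weighted_singularity_le _ r0.
    (* The weight at [s] is the weight at [t] times a decay in t - s, which tames the
       singularity. *)
    rewrite (_ : rho * s = rho * t + - (rho * (t - s))); last by ring.
    rewrite expRD => W.
    have -> : A * (t - s) `^ (1 / 8 - 1) = k * time_ratio ^+ m * expR (rho * t) *
      (rho `^ (- (1 / 8)) * (t - s) `^ (1 / 8 - 1)) by rewrite /A; ring.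
    rewrite (_ : _ * _ = k * time_ratio ^+ m * expR (rho * t) *
      ((t - s) `^ (- (3 / 4)) * expR (- (rho * (t - s))))); last by ring.
    by rewrite ler_wpM2l// !mulr_ge0 ?exprn_ge0 ?time_ratio_ge0 ?expR_ge0.
- under eq_integral do rewrite EFinM.
  rewrite ge0_integralZl//=; last 2 first.
    by apply/measurable_EFinP; exact: measurable_powR_subl.
    by move=> s _; rewrite lee_fin powR_ge0.
  apply: (@le_trans _ _ (A%:E * (t `^ (1 / 8) / (1 / 8))%:E)%E).
    by rewrite lee_wpmul2l ?lee_fin// integral_powR_subl_le//; lra.
  rewrite -EFinM lee_fin.
  (* Replacing t by T makes the ratio the same at every level. *)
  rewrite (_ : k * _ * _ = A * (T `^ (1 / 8) / (1 / 8))); last first.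
    by rewrite /A exprSr {2}/time_ratio; ring.
  rewrite ler_wpM2l// ler_wpM2r ?invr_ge0 ?divr_ge0// ge0_ler_powR ?nnegrE//; lra.
Qed.

End time_iteration.

(** * Summation of the series and the density bound *)

Lemma sum_half_le1 (R : realType) (n : nat) :
  \sum_(1 <= m < n.+1) (1 / 2 : R) ^+ m <= 1.
Proof.
suff -> : \sum_(1 <= m < n.+1) (1 / 2 : R) ^+ m = 1 - (1 / 2) ^+ n.
  by rewrite gerBl exprn_ge0//; lra.
elim: n => [|n IH]; first by rewrite big_geq// expr0 subrr.
by rewrite big_nat_recr//= IH exprS; field.
Qed.

Theorem proposition3p4 (R : realType) (T x0 K lambda alpha : R)
    (T_gt0 : 0 < T) (K_gt0 : 0 < K) (lambda_ge1 : 1 <= lambda)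
    (alpha_ge0 : 0 <= alpha) (alpha_le : alpha <= 1 / 2) :
  exists C : R, 1 <= C /\
    forall (b sigma : R -> R),
      measurable_fun setT b -> measurable_fun setT sigma ->
      (forall x : R, `|b x| <= K) ->
      (forall x y : R, `|sigma x - sigma y| <= K * (`|x - y| `^ (1 / 2 + alpha))) ->
      (forall x : R, lambda^-1 <= sigma x ^+ 2 <= lambda) ->
    forall (d : measure_display) (Omega : measurableType d)
      (P : probability Omega R) (Fil : R -> set (set Omega))
      (W X : R -> Omega -> R),
      filtration_usual P Fil ->
      brownian_motion P Fil W ->
      sde_solution P Fil W b sigma x0 T X ->
    forall (sgn : bool) (p : R -> R -> R),
      (forall t : R, 0 < t <= T -> is_density P (X t) (p t)) ->
      (forall t y : R, 0 < t <= T ->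
         parametrix_expansion b sigma sgn t x0 y (p t y)) ->
    forall (y t : R), 0 < t <= T ->
      p t y <= C * gauss_kernel (8 * lambda) t x0 y.
Proof.
have l0 : 0 < lambda by exact: lt_le_trans lambda_ge1.
have c0 : 0 < 8 * lambda by rewrite mulr_gt0.
pose M := kernel_const T K lambda.
have M0 : 0 <= M by exact: kernel_const_ge0.
have Te0 : 0 < T `^ (1 / 8) by exact: powR_gt0.
(* With rho = D^8 the ratio q is 8 T^(1/8) / D = 1 / (2 (M + 1)), so M q <= 1/2; M + 1 keeps [D]
   positive. *)
pose D := 16 * (M + 1) * T `^ (1 / 8).
have D0 : 0 < D by rewrite /D !mulr_gt0//; lra.
pose rho := D ^+ 8.
have rho0 : 0 < rho by exact: exprn_gt0.
have ratioE : time_ratio T rho = (2 * (M + 1))^-1.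
  rewrite /time_ratio powRN /rho -powR_mulrn ?(ltW D0)// -powRrM.
  rewrite (_ : 8%:R * (1 / 8) = 1) ?powRr1 ?(ltW D0)//; last by field.
  by rewrite /D; field; rewrite !gt_eqF//; lra.
have ratio0 := time_ratio_ge0 T rho.
have Mr0 : 0 <= M * time_ratio T rho by exact: mulr_ge0.
pose E := expR (rho * T).
have E0 : 0 <= E by exact: expR_ge0.
have E1 : 1 <= E by rewrite -expR0 ler_expR mulr_ge0 ?ltW.
exists (1 + 2 * M * E); split; first by rewrite lerDl mulr_ge0// mulr_ge0.
move=> b sigma _ _ b_le sigma_holder sigma_sqr d Omega P Fil W X _ _ _ sgn p _ p_exp
  y t /andP[t0 tT].
set G := gauss_kernel _ t x0 y.
have G0 : 0 <= G by exact: gauss_kernel_ge0.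
have frozen_le s x z : 0 <= s <= T ->
    `|frozen_density b sigma z s x z| <= M * gauss_kernel (8 * lambda) s x z.
  exact: frozen_density_gauss_le.
have theta_le s x z : 0 <= s <= T ->
    `|theta_hat b sigma sgn s x z * frozen_density b sigma z s x z| <=
    M * s `^ (- (3 / 4)) * gauss_kernel (8 * lambda) s x z.
  exact: (theta_frozen_density_gauss_le _ _ _ alpha).
have I_le m : `|I_hat b sigma sgn m t y x0| <= M * E * G * (1 / 2) ^+ m.
  have H : `|I_hat b sigma sgn m t y x0| <=
      M ^+ m.+1 * G * time_ratio T rho ^+ m * expR (rho * t).
    apply: time_integral_le => //.
    - by rewrite mulr_ge0 ?exprn_ge0.
    - by rewrite ltW.
    - move=> ts sz pts l.
      rewrite mulrAC -[M ^+ _]mul1r /G gauss_kernelC.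
      apply: (space_integral_le _ _ _ _ _ _ c0 M0 frozen_le theta_le) => // ys _.
      by rewrite mul1r.
  rewrite (le_trans H)//.
  (* Regrouping M^(m+1) q^m as M (M q)^m exposes the geometric decay. *)
  rewrite (_ : _ * expR _ = M * G * ((M * time_ratio T rho) ^+ m * expR (rho * t))).
    have -> : M * E * G * (1 / 2) ^+ m = M * G * ((1 / 2) ^+ m * E) by ring.
    apply: ler_wpM2l; first by rewrite mulr_ge0.
    apply: ler_pM; rewrite ?exprn_ge0 ?expR_ge0//.
      rewrite lerXn2r ?nnegrE ?divr_ge0//.
      by rewrite ratioE ler_pdivrMr; lra.
    by rewrite ler_expR ler_pM2l.
  by rewrite [(M * _) ^+ m]exprMn exprS; ring.
(* A bound uniform over the partial sums passes to their limit [p t y]. *)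
apply: cvgr_to_le (p_exp t y _) _; first by rewrite t0.
apply: nearW => n; rewrite (le_trans (ler_norm _))// (le_trans (ler_normD _ _))//.
have frozen_G : `|frozen_density b sigma y t x0 y| <= M * E * G.
  rewrite (le_trans (frozen_le t x0 y _)) ?(ltW t0)//.
  by rewrite ler_wpM2r// ler_peMr.
have series_G : `|\sum_(1 <= m < n.+1) I_hat b sigma sgn m t y x0| <= M * E * G.
  rewrite (le_trans (ler_norm_sum _ _ _))//.
  rewrite (le_trans (ler_sum _ (fun m _ => I_le m)))// -mulr_sumr.
  by rewrite ler_piMr ?sum_half_le1//; exact: mulr_ge0 (mulr_ge0 M0 E0) G0.
lra.
Qed.
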